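(* Let $f:\mathbb{R}^d\to\mathbb{R}$ be a quadratic function with constant Hessian matrix $H=\nabla^2 f$, i.e. $f(z)=f(\mu)+\langle\nabla f(\mu),z-\mu\rangle+\frac12(z-\mu)^\top H(z-\mu)$ for all $z,\mu\in\mathbb{R}^d$. Assume that $f$ is $L$-smooth and $\sigma$-strongly convex, with $L,\sigma>0$. Let $\mu_*$ be the minimizer of $f$. Then the minimizer of $Q_\alpha$ over $\mu\in\mathbb{R}^d$ and $\Sigma\in\mathcal{S}$ is $$\left(\mu_*,\ \Pi_{\mathcal{S}}\left(H^{-1}\right)\right)=\operatorname*{arg\,min}_{\mu\in\mathbb{R}^d,\ \Sigma\in\mathcal{S}} Q_\alpha(\mu,\Sigma).$$
   Context: Fix constants $\alpha>0$ and $0<\tau\le\zeta$. For $\mu\in\mathbb{R}^d$ and a symmetric positive definite $d\times d$ matrix $\Sigma$, define $$J(\mu,\Sigma)=\mathbb{E}_{u\sim N(0,I_d)}\left[f(\mu+\alpha\Sigma^{1/2}u)\right],\qquad Q_\alpha(\mu,\Sigma)=J(\mu,\Sigma)-\frac{\alpha^2}{2}\log\det\Sigma .$$ $\mathcal{S}=\{\Sigma \text{ symmetric } d\times d:\ \zeta^{-1}I\preceq\Sigma\preceq\tau^{-1}I\}$, where $\preceq$ is the Loewner order. For symmetric $A$, $\Pi_{\mathcal{S}}(A)=\operatorname*{arg\,min}_{X\in\mathcal{S}}\|A-X\|$ with $\|\cdot\|$ the Frobenius norm. $f$ is $L$-smooth if $\|\nabla f(\mu_1)-\nabla f(\mu_2)\|\le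 L\|\mu_1-\mu_2\|$ for all $\mu_1,\mu_2\in\mathbb{R}^d$; it is $\sigma$-strongly convex if $f(\mu_1)-f(\mu_2)\ge\langle\nabla f(\mu_2),\mu_1-\mu_2\rangle+\frac{\sigma}{2}\|\mu_1-\mu_2\|^2$ for all $\mu_1,\mu_2\in\mathbb{R}^d$ (Euclidean norm on vectors). *)

(* Defs.v *)
From HB Require Import structures.
From mathcomp Require Import all_boot all_order all_algebra.
From mathcomp Require Import all_classical all_reals all_analysis.

Set Implicit Arguments.
Unset Strict Implicit.
Unset Printing Implicit Defensive.

Import Order.TTheory GRing.Theory Num.Theory.
Import numFieldNormedType.Exports.

Local Open Scope classical_set_scope.
Local Open Scope ring_scope.

(* The set of all minimizers: [argmin D F = [set x]] says that [x] is the
   unique minimizer of [F] over [D]. *)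
Definition argmin (R : realType) (T : Type) (D : set T) (F : T -> R) : set T :=
  [set x | D x /\ forall y, D y -> F x <= F y].

Section Euclidean.
Context {R : realType}.

Definition dotv d (u v : 'cV[R]_d) : R := (u^T *m v) 0 0.

(* The norm the library puts on matrices is the sup norm. On column vectors
   the Frobenius norm is the Euclidean one. *)
Definition fnorm m n (A : 'M[R]_(m, n)) : R :=
  Num.sqrt (\sum_i \sum_j A i j ^+ 2).

Definition symmetric_mx d (A : 'M[R]_d) : Prop := A^T = A.

Definition psd_mx d (A : 'M[R]_d) : Prop :=
  symmetric_mx A /\ forall x : 'cV[R]_d, 0 <= dotv x (A *m x).

Definition loewner_le d (A B : 'M[R]_d) : Prop := psd_mx (B - A).

(* The unique positive semidefinite square root when [A] is positive
   semidefinite; junk value [0] otherwise. *)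
Definition sqrt_mx d (A : 'M[R]_d) : 'M[R]_d :=
  xget 0 [set B : 'M[R]_d | psd_mx B /\ B *m B = A].

Definition Sset d (tau zeta : R) : set 'M[R]_d :=
  [set X | [/\ symmetric_mx X, loewner_le (zeta^-1)%:M X
             & loewner_le X (tau^-1)%:M]].

(* Junk value [0] if the distance to [A] has no minimizer on [S]; it has a
   unique one when [S] is nonempty, closed and convex. *)
Definition proj_mx_set d (S : set 'M[R]_d) (A : 'M[R]_d) : 'M[R]_d :=
  xget 0 (argmin S (fun X => fnorm (A - X))).

End Euclidean.

Section Smoothness.
Context {R : realType} {d : nat}.
Implicit Types (f : 'cV[R]_d -> R).

Definition basis_vec (i : 'I_d) : 'cV[R]_d := delta_mx i 0.

Definition grad f (x : 'cV[R]_d) : 'cV[R]_d := \col_i 'D_(basis_vec i) f x.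

Definition hessian f (x : 'cV[R]_d) : 'M[R]_d :=
  \matrix_(i, j) 'D_(basis_vec i) (fun y => 'D_(basis_vec j) f y) x.

Definition quadratic_with_hessian f (H : 'M[R]_d) : Prop :=
  (forall x, hessian f x = H) /\
  (forall z mu, f z = f mu + dotv (grad f mu) (z - mu)
                      + 2^-1 * dotv (z - mu) (H *m (z - mu))).

Definition smooth f (L : R) : Prop :=
  (forall x, differentiable f x) /\
  (forall mu1 mu2, fnorm (grad f mu1 - grad f mu2) <= L * fnorm (mu1 - mu2)).

Definition strongly_convex f (sigma : R) : Prop :=
  (forall x, differentiable f x) /\
  (forall mu1 mu2, f mu1 - f mu2 >=
     dotv (grad f mu2) (mu1 - mu2) + sigma / 2 * fnorm (mu1 - mu2) ^+ 2).

End Smoothness.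

Section Gaussian.
Context {R : realType}.

Definition cons_pair n (p : measurableTypeR R * n.-tuple (measurableTypeR R)) :
  n.+1.-tuple (measurableTypeR R) := [tuple of p.1 :: p.2].

Lemma measurable_cons_pair n : measurable_fun setT (@cons_pair n).
Proof. exact: measurable_cons. Qed.

HB.instance Definition _ n :=
  isMeasurableFun.Build _ _ _ _ (@cons_pair n) (@measurable_cons_pair n).

(* N(0, I_n) as the n-fold product of N(0, 1). *)
Fixpoint std_gaussian (n : nat) :
    probability (n.-tuple (measurableTypeR R)) R :=
  match n with
  | 0 => dirac [tuple]
  | m.+1 => distribution (normal_prob 0 1 \x std_gaussian m)%E (@cons_pair m)
  end.

Definition col_of_tuple d (u : d.-tuple R) : 'cV[R]_d := \col_i tnth u i.

End Gaussian.

Section Objective.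
Context {R : realType} {d : nat}.

Definition Jfun (alpha : R) (f : 'cV[R]_d -> R) (mu : 'cV[R]_d)
    (Sigma : 'M[R]_d) : R :=
  fine ('E_(std_gaussian d)
    [fun u => f (mu + alpha *: (sqrt_mx Sigma *m col_of_tuple u))%R])%E.

Definition Qfun (alpha : R) (f : 'cV[R]_d -> R) (mu : 'cV[R]_d)
    (Sigma : 'M[R]_d) : R :=
  Jfun alpha f mu Sigma - alpha ^+ 2 / 2 * ln (\det Sigma).

End Objective.

(* Main.v *)
Require Import Defs.
From HB Require Import structures.
From mathcomp Require Import all_boot all_order all_algebra.
From mathcomp Require Import all_classical all_reals all_analysis.
From mathcomp Require Import measurable_realfun complex.
From mathcomp Require Import ring lra zify.
Import Order.TTheory GRing.Theory Num.Theory.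
Import numFieldNormedType.Exports.
Local Open Scope classical_set_scope.
Local Open Scope ring_scope.

Set Implicit Arguments.
Unset Strict Implicit.
Unset Printing Implicit Defensive.

(* Strong convexity makes [H] positive definite, and for a quadratic [f]
   [Q(mu, S) = f mu + alpha^2/2 * (tr (H S) - ln det S)], because the first two
   moments of [N(0, I)] are [0] and [I].  So [mu] and [S] decouple.  Diagonalize
   [H = P^T diag(lam) P] with [P] orthogonal, and let [Xs = P^T diag(c) P],
   where [c_i] is [1 / lam_i] clipped to [[1/zeta, 1/tau]].  For [X] in the constraint
   set the diagonal of [Y = P X P^T] lies in that interval, so that
   [(1/lam_i - c_i) (c_i - Y_ii) >= 0].  This one inequality gives both
   [|H^-1 - Xs|^2 + |Xs - X|^2 <= |H^-1 - X|^2], i.e. [Xs] is the projection,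
   and, with [ln det M <= tr M - d] applied to [M = diag(c)^(-1/2) Y diag(c)^(-1/2)]
   (equality only for [M = 1]), that [Xs] is the only minimizer of
   [tr (H X) - ln det X]. *)

(** * The spectral theorem for real symmetric matrices *)

(** Over the complex extension the matrix is Hermitian, so it is unitarily diagonalizable with real
    spectrum, and row 0 of the diagonalizing matrix is an eigenvector. A real eigenvalue descends to
    [R] as a root of the characteristic polynomial. *)
Lemma symmetric_real_eigenvalue (R : rcfType) n (A : 'M[R]_n.+1) :
  A^T = A -> exists a, eigenvalue A a.
Proof.
move=> symA; pose AC := map_mx (real_complex R) A.
have symAC : AC \is symmetricmx.
  apply/is_hermitianmxP; rewrite expr0 scale1r map_mx_id//.
  by apply/matrixP => i j; rewrite !mxE -[in LHS]symA mxE.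
have hAC : AC \is hermsymmx.
  apply: realsym_hermsym => //; apply/mxOverP => i j; rewrite mxE.
  by apply/complex_realP; exists (A i j).
have := hermitian_spectral_diag_real hAC => /mxOverP /(_ 0 0).
set D := spectral_diag AC; move/complex_realP => [a Da].
exists a; rewrite eigenvalue_root_char -(fmorph_root (real_complex R)).
rewrite map_char_poly -eigenvalue_root_char.
have /orthomx_spectralP spE := hermitian_normalmx hAC.
set P := spectralmx AC in spE.
have Pu : P \in unitmx by exact: spectral_unit.
have rP : row 0 P *m AC = a%:C%C *: row 0 P.
  rewrite {1}spE !mulmxA -row_mul mulmxV// row1 -rowE.
  by rewrite row_diag_mx -scalemxAl -rowE -Da.
apply/eigenvalueP; exists (row 0 P) => //.
apply: contraTneq Pu => P0; rewrite unitmxE unitfE negbK.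
rewrite (expand_det_row _ 0) big1// => j _.
by have /rowP/(_ j) := P0; rewrite !mxE => ->; rewrite mul0r.
Qed.

Lemma trmx_mul_self_ge0 (R : realDomainType) n (v : 'cV[R]_n) :
  0 <= (v^T *m v) 0 0.
Proof. by rewrite mxE sumr_ge0// => i _; rewrite mxE -expr2 sqr_ge0. Qed.

Lemma trmx_mul_self_eq0 (R : realDomainType) n (v : 'cV[R]_n) :
  (v^T *m v) 0 0 = 0 -> v = 0.
Proof.
rewrite mxE => /eqP; rewrite psumr_eq0 => [/allP vv0|i _]; last first.
  by rewrite mxE -expr2 sqr_ge0.
apply/colP => i; rewrite mxE; apply/eqP.
by have := vv0 i; rewrite mem_index_enum mxE -expr2 sqrf_eq0 => /(_ isT).
Qed.

(** The reflection in the hyperplane orthogonal to [u - v] exchanges the two unit vectors; when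
    [u = v] the identity serves instead. *)
Lemma householder (R : rcfType) n (u v : 'cV[R]_n) :
  (u^T *m u) 0 0 = 1 -> (v^T *m v) 0 0 = 1 ->
  exists Q : 'M[R]_n, [/\ Q^T = Q, Q *m Q = 1%:M & Q *m u = v].
Proof.
move=> uu vv; pose w := u - v; pose s := (w^T *m w) 0 0.
have [w0|s0] := eqVneq s 0.
  exists 1%:M; split; rewrite ?trmx1 ?mul1mx//.
  by apply/eqP; rewrite -subr_eq0; apply/eqP/trmx_mul_self_eq0.
have wwT : w^T *m w = s%:M by rewrite [LHS]mx11_scalar.
have uvC : (u^T *m v) 0 0 = (v^T *m u) 0 0.
  by rewrite !mxE; apply: eq_bigr => i _; rewrite !mxE mulrC.
(* Both vectors have norm 1, so [s = 2 - 2 <u, v>] while [<w, u> = 1 - <u, v>]. *)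
have wu : w^T *m u = (s / 2)%:M.
  rewrite [LHS]mx11_scalar; congr (_%:M).
  have -> : s = (u^T *m u) 0 0 - (u^T *m v) 0 0
      - ((v^T *m u) 0 0 - (v^T *m v) 0 0).
    by rewrite /s /w [(u - v)^T]linearB/= mulmxBl !mulmxBr !mxE.
  have -> : (w^T *m u) 0 0 = (u^T *m u) 0 0 - (v^T *m u) 0 0.
    by rewrite /w [(u - v)^T]linearB/= mulmxBl !mxE.
  by rewrite uu vv uvC; field.
exists (1%:M - (2 / s) *: (w *m w^T)); split.
- by rewrite linearB/= trmx1 linearZ/= trmx_mul trmxK.
- rewrite mulmxBl mul1mx mulmxBr mulmx1 -scalemxAl -scalemxAr.
  rewrite -mulmxA (mulmxA w^T) wwT mul_scalar_mx -scalemxAr !scalerA.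
  rewrite (_ : 2 / s * (2 / s * s) = 2 / s + 2 / s); last by field.
  by rewrite scalerDl opprB addrK subrK.
- rewrite mulmxBl mul1mx -scalemxAl -mulmxA wu mul_mx_scalar scalerA.
  by rewrite (_ : 2 / s * (s / 2) = 1) ?scale1r ?opprB ?subrKC//; field.
Qed.

(** Induction on the dimension. A reflection [Q] carries the first basis vector to a unit
    eigenvector, so the first column of [Q A Q] is [a e]; by symmetry its first row is too, and the
    induction hypothesis applies to the remaining diagonal block. *)
Lemma real_spectral (R : rcfType) n (A : 'M[R]_n) : A^T = A ->
  exists P (lam : 'rV[R]_n), P^T *m P = 1%:M /\ A = P^T *m diag_mx lam *m P.
Proof.
elim: n A => [|n IHn] A symA.
  by exists 1%:M, 0; rewrite [A]flatmx0 [RHS in _ /\ _ = RHS]flatmx0 trmx1 mulmx1.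
have [a /eigenvalueP[v vA v0]] := symmetric_real_eigenvalue symA.
pose s := (v *m v^T) 0 0.
have s_gt0 : 0 < s.
  have := trmx_mul_self_ge0 v^T; rewrite trmxK le_eqVlt => /predU1P[vv0|//].
  have := @trmx_mul_self_eq0 _ _ v^T; rewrite trmxK => /(_ (esym vv0)) /eqP.
  by rewrite trmx_eq0 (negbTE v0).
pose u := (Num.sqrt s)^-1 *: v^T.
have uu : (u^T *m u) 0 0 = 1.
  rewrite /u [(_ *: _)^T]linearZ/= -scalemxAl -scalemxAr trmxK scalerA mxE.
  by rewrite -invfM -expr2 sqr_sqrtr ?ltW// mulVf ?gt_eqF.
have Au : A *m u = a *: u.
  by rewrite -scalemxAr -symA -trmx_mul vA linearZ/= !scalerA mulrC.
pose e : 'cV[R]_(1 + n) := delta_mx 0 0.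
have ee : (e^T *m e) 0 0 = 1 by rewrite trmx_delta mul_delta_mx mxE.
have [Q [symQ QQ Qe]] := householder ee uu.
have Qu : Q *m u = e by rewrite -Qe mulmxA QQ mul1mx.
have [B BQ] : exists B : 'M[R]_(1 + n), B = Q *m A *m Q by exists (Q *m A *m Q).
have symB : B^T = B by rewrite BQ !trmx_mul symQ symA mulmxA.
have Be : B *m e = a *: e.
  by rewrite BQ -mulmxA Qe -mulmxA Au -scalemxAr Qu.
have Bi0 i : B i 0 = a *+ (i == 0).
  by have /colP/(_ i) := Be; rewrite -colE !mxE eqxx andbT mulr_natr.
have B0i i : B 0 i = a *+ (i == 0) by rewrite -Bi0 -[in RHS]symB mxE.
have symB' : (drsubmx B)^T = drsubmx B by rewrite trmx_drsub symB.
have [P' [lam' [PP' B'E]]] := IHn _ symB'.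
have BE : B = block_mx a%:M 0 0 (drsubmx B).
  rewrite -[LHS]submxK; congr block_mx.
  - by rewrite [LHS]mx11_scalar !mxE lshift0 Bi0.
  - by apply/matrixP => i j; rewrite !mxE (ord1 i) lshift0 B0i.
  - by apply/matrixP => i j; rewrite !mxE (ord1 j) lshift0 Bi0.
pose S : 'M[R]_(1 + n) := block_mx 1%:M 0 0 P'.
have SS : S^T *m S = 1%:M.
  rewrite /S tr_block_mx !trmx0 trmx1 mulmx_block !(mul0mx, mulmx0, mulmx1).
  by rewrite PP' !addr0 !add0r -scalar_mx_block.
exists (S *m Q), (row_mx a%:M lam'); split.
  by rewrite trmx_mul mulmxA -(mulmxA _ S^T) SS mulmx1 symQ.
have BES : B = S^T *m diag_mx (row_mx a%:M lam') *m S.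
  rewrite BE B'E diag_mx_row /S tr_block_mx !trmx0 trmx1.
  rewrite !mulmx_block !(mul0mx, mulmx0, mulmx1, mul1mx) !addr0 !add0r.
  congr block_mx; last by rewrite mul0mx.
  by apply/matrixP => i j; rewrite !mxE !ord1.
rewrite trmx_mul symQ !mulmxA -(mulmxA Q S^T) -!mulmxA.
rewrite (mulmxA S^T) (mulmxA (S^T *m _)).
by rewrite -BES BQ !mulmxA QQ mul1mx -mulmxA QQ mulmx1.
Qed.

(** * Positive definite matrices *)

Section MatrixFacts.
Context {R : realType}.
Implicit Types (d : nat).

Lemma dotvE d (u v : 'cV[R]_d) : dotv u v = \sum_i u i 0 * v i 0.
Proof. by rewrite /dotv mxE; apply: eq_bigr => i _; rewrite mxE. Qed.

Lemma dotv_mulmxr d (A : 'M[R]_d) (u v : 'cV[R]_d) :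
  dotv u (A *m v) = dotv (A^T *m u) v.
Proof. by rewrite /dotv trmx_mul trmxK mulmxA. Qed.

Lemma fnorm_sqr m n (A : 'M[R]_(m, n)) :
  fnorm A ^+ 2 = \sum_i \sum_j A i j ^+ 2.
Proof.
rewrite sqr_sqrtr// sumr_ge0// => i _; rewrite sumr_ge0// => j _.
exact: sqr_ge0.
Qed.

Lemma fnorm_ge0 m n (A : 'M[R]_(m, n)) : 0 <= fnorm A.
Proof. exact: sqrtr_ge0. Qed.

Lemma fnorm_sqr_mxtrace m n (A : 'M[R]_(m, n)) : fnorm A ^+ 2 = \tr (A *m A^T).
Proof.
rewrite fnorm_sqr; apply: eq_bigr => i _; rewrite mxE.
by apply: eq_bigr => j _; rewrite mxE expr2.
Qed.

Lemma fnorm_sqr_dotv d (v : 'cV[R]_d) : fnorm v ^+ 2 = dotv v v.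
Proof. by rewrite fnorm_sqr_mxtrace mxtrace_mulC /mxtrace big_ord1. Qed.

Lemma fnorm_eq0 m n (A : 'M[R]_(m, n)) : fnorm A ^+ 2 = 0 -> A = 0.
Proof.
have ge0 i : 0 <= \sum_j A i j ^+ 2 by rewrite sumr_ge0// => j _; rewrite sqr_ge0.
move=> /eqP; rewrite fnorm_sqr psumr_eq0// => /allP A0.
apply/matrixP => i j; have := A0 i (mem_index_enum _).
rewrite psumr_eq0 => [/allP /(_ j (mem_index_enum _))|k _]; last exact: sqr_ge0.
by rewrite sqrf_eq0 mxE => /eqP.
Qed.

Lemma fnorm_orthogonal d (P A : 'M[R]_d) : P^T *m P = 1%:M ->
  fnorm (P *m A *m P^T) ^+ 2 = fnorm A ^+ 2.
Proof.
move=> PP; rewrite !fnorm_sqr_mxtrace !trmx_mul trmxK !mulmxA.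
by rewrite -(mulmxA _ P^T P) PP mulmx1 mxtrace_mulC !mulmxA PP mul1mx.
Qed.

Lemma dotv_diag_conj d (P : 'M[R]_d) (c : 'rV[R]_d) (x : 'cV[R]_d) :
  dotv x (P^T *m diag_mx c *m P *m x) = \sum_i c 0 i * (P *m x) i 0 ^+ 2.
Proof.
rewrite -!mulmxA dotv_mulmxr trmxK mul_diag_mx dotvE.
by apply: eq_bigr => i _; rewrite 2!mxE [(P *m x) i 0]mxE; ring.
Qed.

(** Diagonal entries in the basis [P] are values of the quadratic form, which is how Loewner bounds
    and positivity reach them. *)
Lemma conj_diagE d (P A : 'M[R]_d) i :
  (P *m A *m P^T) i i = dotv (P^T *m delta_mx i 0) (A *m (P^T *m delta_mx i 0)).
Proof.
rewrite /dotv trmx_mul trmxK trmx_delta -!mulmxA -rowE [RHS]mxE !mulmxA -colE.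
by rewrite [RHS]mxE.
Qed.

(** As [sqrt_mx] is chosen by [xget], exhibiting one positive semidefinite root suffices: take
    square roots of the eigenvalues. *)
Lemma sqrt_mxP d (A : 'M[R]_d) : psd_mx A ->
  psd_mx (sqrt_mx A) /\ sqrt_mx A *m sqrt_mx A = A.
Proof.
move=> [symA A0]; rewrite /sqrt_mx; case: xgetP => [B _ //|].
have [P [c [PP AE]]] := real_spectral symA.
have PP' : P *m P^T = 1%:M by exact: mulmx1C.
have c0 i : 0 <= c 0 i.
  have := A0 (P^T *m delta_mx i 0); rewrite -conj_diagE AE !mulmxA PP' mul1mx.
  by rewrite -mulmxA PP' mulmx1 mxE eqxx mulr1n.
pose s : 'rV[R]_d := \row_i Num.sqrt (c 0 i).
move=> /(_ (P^T *m diag_mx s *m P)); case; split; first split.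
- by rewrite /symmetric_mx !trmx_mul trmxK tr_diag_mx mulmxA.
- move=> x; rewrite dotv_diag_conj sumr_ge0// => i _.
  by rewrite mxE mulr_ge0 ?sqrtr_ge0 ?sqr_ge0.
- rewrite AE !mulmxA -(mulmxA _ P P^T) PP' mulmx1.
  rewrite -(mulmxA P^T (diag_mx _)) mulmx_diag.
  congr (_ *m diag_mx _ *m _); apply/rowP => i.
  by rewrite !mxE -expr2 sqr_sqrtr.
Qed.

(** Termwise [ln x <= x - 1]. Equality forces [x = 1], since [1 + y < expR y] strictly at [y = ln x]
    when [y] is nonzero. *)
Lemma sum_sub_ln_ge0 d (m : 'I_d -> R) : (forall i, 0 < m i) ->
  0 <= \sum_i (m i - 1) - ln (\prod_i m i) /\
  (\sum_i (m i - 1) - ln (\prod_i m i) = 0 -> forall i, m i = 1).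
Proof.
move=> m0.
have lnp : ln (\prod_i m i) = \sum_i ln (m i).
  have [] : 0 < \prod_i m i /\ ln (\prod_i m i) = \sum_i ln (m i); last by [].
  elim/big_rec2 : _ => [|i s p _ [p0 <-]]; first by rewrite ln1.
  by rewrite mulr_gt0// lnM ?posrE.
have t0 i : 0 <= m i - 1 - ln (m i).
  have := @le_ln1Dx R (m i - 1); rewrite subrKC; have := m0 i; lra.
rewrite lnp -sumrB; split; first by rewrite sumr_ge0.
move=> /eqP; rewrite psumr_eq0// => /allP /= t1 i.
have /eqP := t1 i (mem_index_enum _).
have [//|m1] := eqVneq (m i) 1 => lnm.
have := @expR_gt1Dx R (ln (m i)).
rewrite lnK ?posrE// ln_eq0//.
by move=> /(_ m1); lra.
Qed.

(** Each eigenvalue is the value of the form at a column of [P^T], and this column is nonzero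
    because [P] is invertible. *)
Lemma posdef_spectral d (M : 'M[R]_d) : M^T = M ->
  (forall x, x != 0 -> 0 < dotv x (M *m x)) ->
  exists P (m : 'rV[R]_d), [/\ P^T *m P = 1%:M, M = P^T *m diag_mx m *m P &
    forall i, 0 < m 0 i].
Proof.
move=> symM M0; have [P [m [PP ME]]] := real_spectral symM.
have PP' : P *m P^T = 1%:M by exact: mulmx1C.
exists P, m; split=> // i.
have := M0 (P^T *m delta_mx i 0); rewrite -conj_diagE ME !mulmxA PP' mul1mx.
rewrite -mulmxA PP' mulmx1 mxE eqxx mulr1n; apply.
apply/negP => /eqP /(congr1 (mulmx P)); rewrite mulmxA PP' mul1mx mulmx0.
by move=> /matrixP /(_ i 0) /eqP; rewrite !mxE !eqxx oner_eq0.
Qed.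

Lemma det_diag_conj d (P : 'M[R]_d) (m : 'rV[R]_d) : P^T *m P = 1%:M ->
  \det (P^T *m diag_mx m *m P) = \prod_i m 0 i.
Proof.
move=> PP.
by rewrite !det_mulmx mulrC mulrA -det_mulmx (mulmx1C PP) det1 mul1r det_diag.
Qed.

Lemma posdef_det_gt0 d (M : 'M[R]_d) : M^T = M ->
  (forall x, x != 0 -> 0 < dotv x (M *m x)) -> 0 < \det M.
Proof.
move=> symM /(posdef_spectral symM)[P [m [PP -> m0]]].
by rewrite det_diag_conj// prodr_gt0.
Qed.

(* The tangent-plane inequality of the concave function [ln \o \det] at the
   identity, with its equality case. *)
Lemma ln_det_le_mxtrace d (M : 'M[R]_d) : M^T = M ->
  (forall x, x != 0 -> 0 < dotv x (M *m x)) ->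
  ln (\det M) <= \tr M - d%:R /\ (ln (\det M) = \tr M - d%:R -> M = 1%:M).
Proof.
move=> symM /(posdef_spectral symM)[P [m [PP ME m0]]].
have trM : \tr M - d%:R = \sum_i (m 0 i - 1).
  rewrite ME mxtrace_mulC mulmxA (mulmx1C PP) mul1mx mxtrace_diag sumrB.
  by rewrite sumr_const card_ord.
have [ge0 eq0] := sum_sub_ln_ge0 m0.
rewrite trM ME det_diag_conj//; split; first by rewrite -subr_ge0.
move=> /eqP; rewrite eq_sym -subr_eq0 => /eqP /eq0 m1.
rewrite (_ : m = const_mx 1) ?diag_const_mx ?mulmx1//.
by apply/rowP => i; rewrite m1 mxE.
Qed.

End MatrixFacts.

(** * Projection and log-determinant minimization over the constraint set *)

Section Clipping.
Context {R : realType}.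
Implicit Types (d : nat) (lo hi x y tau zeta : R).

Definition clip lo hi x := Num.max lo (Num.min x hi).

Lemma clip_itv lo hi x : lo <= hi -> lo <= clip lo hi x <= hi.
Proof. by move=> lohi; rewrite /clip le_max lexx ge_max lohi ge_min lexx orbT. Qed.

(** The variational inequality for the nearest point of an interval: either [x] is its own clipping,
    or the clipping is the endpoint that separates [x] from [y]. *)
Lemma clip_obtuse lo hi x y : lo <= y <= hi ->
  0 <= (x - clip lo hi x) * (clip lo hi x - y).
Proof.
move=> /andP[loy yhi]; rewrite /clip; case: (leP x hi) => xhi.
  case: (leP lo x) => lox; first by rewrite subrr mul0r.
  by rewrite mulr_le0// subr_le0// ltW.
have -> : Num.max lo hi = hi by apply/max_idPr/(le_trans loy).
by rewrite mulr_ge0// subr_ge0// ltW.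
Qed.

(** The two Loewner bounds are tested on the [i]-th column of [P^T], a unit vector. *)
Lemma Sset_conj_diag d tau zeta (P X : 'M[R]_d) i : P^T *m P = 1%:M ->
  Sset tau zeta X -> zeta^-1 <= (P *m X *m P^T) i i <= tau^-1.
Proof.
move=> PP [_ [_ /(_ (P^T *m delta_mx i 0)) lo] [_ /(_ (P^T *m delta_mx i 0)) hi]].
have scal (a : R) : (P *m a%:M *m P^T) i i = a.
  by rewrite mul_mx_scalar -scalemxAl (mulmx1C PP) !mxE eqxx mulr1.
have subE (A B : 'M[R]_d) : (P *m (A - B) *m P^T) i i =
    (P *m A *m P^T) i i - (P *m B *m P^T) i i.
  by rewrite mulmxBr mulmxBl mxE; congr (_ + _); rewrite mxE.
by move: lo hi; rewrite -!conj_diagE !subE !scal !subr_ge0 => -> ->.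
Qed.

(** Scalar matrices are diagonal in every orthonormal basis, so both Loewner bounds reduce to
    entrywise bounds on [c]. *)
Lemma Sset_diag_conj d tau zeta (P : 'M[R]_d) (c : 'rV[R]_d) :
  P^T *m P = 1%:M -> (forall i, zeta^-1 <= c 0 i <= tau^-1) ->
  Sset tau zeta (P^T *m diag_mx c *m P).
Proof.
move=> PP c_itv.
have sym (e : 'rV[R]_d) : symmetric_mx (P^T *m diag_mx e *m P).
  by rewrite /symmetric_mx !trmx_mul trmxK tr_diag_mx mulmxA.
have scal (a : R) : a%:M = P^T *m diag_mx (const_mx a) *m P.
  by rewrite diag_const_mx mul_mx_scalar -scalemxAl PP scalemx1.
have psdB (e e' : 'rV[R]_d) : (forall i, e 0 i <= e' 0 i) ->
    loewner_le (P^T *m diag_mx e *m P) (P^T *m diag_mx e' *m P).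
  move=> ee'; rewrite /loewner_le (_ : _ - _ = P^T *m diag_mx (e' - e) *m P);
    last by rewrite [diag_mx (_ - _)]raddfB mulmxBr mulmxBl.
  split => // x; rewrite dotv_diag_conj sumr_ge0// => i _.
  by rewrite mulr_ge0 ?sqr_ge0// !mxE subr_ge0.
split=> //; rewrite scal; apply: psdB => i; rewrite mxE.
  by case/andP: (c_itv i).
by case/andP: (c_itv i).
Qed.

Lemma Sset_gt0 d tau zeta (X : 'M[R]_d) (x : 'cV[R]_d) : 0 < zeta ->
  Sset tau zeta X -> x != 0 -> 0 < dotv x (X *m x).
Proof.
move=> zeta0 [_ [_ /(_ x)] + _] x0.
rewrite mulmxBl /dotv mulmxBr mxE [X in _ + X]mxE mul_scalar_mx -scalemxAr.
rewrite subr_ge0; apply: lt_le_trans; rewrite mxE mulr_gt0 ?invr_gt0//.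
rewrite lt_neqAle trmx_mul_self_ge0 andbT eq_sym.
by apply: contra_neq x0 => /trmx_mul_self_eq0.
Qed.

Variables (d : nat) (tau zeta : R) (P : 'M[R]_d) (lam : 'rV[R]_d).
Hypotheses (tau0 : 0 < tau) (tauzeta : tau <= zeta) (PP : P^T *m P = 1%:M).
Hypothesis lam0 : forall i, 0 < lam 0 i.

Let H := P^T *m diag_mx lam *m P.
Let c := \row_i clip zeta^-1 tau^-1 (lam 0 i)^-1.
Let Xs := P^T *m diag_mx c *m P.

Let zeta0 : 0 < zeta. Proof. exact: lt_le_trans tauzeta. Qed.
Let c_itv i : zeta^-1 <= c 0 i <= tau^-1.
Proof. by rewrite mxE clip_itv// lef_pV2. Qed.
Let c0 i : 0 < c 0 i.
Proof. by case/andP: (c_itv i) => + _; apply: lt_le_trans; rewrite invr_gt0. Qed.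
Let PP' : P *m P^T = 1%:M. Proof. exact: mulmx1C. Qed.
Let XsS : Sset tau zeta Xs. Proof. exact: Sset_diag_conj. Qed.

Lemma invmx_diag_conj : invmx H = P^T *m diag_mx (\row_i (lam 0 i)^-1) *m P.
Proof.
set K := RHS; have HK : H *m K = 1%:M.
  rewrite /H /K !mulmxA -(mulmxA _ P P^T) PP' mulmx1 -(mulmxA P^T (diag_mx _)).
  rewrite mulmx_diag (_ : \row_i _ = const_mx 1) ?diag_const_mx ?mulmx1//.
  by apply/rowP => i; rewrite !mxE divff ?gt_eqF.
have [Hu _] := mulmx1_unit HK.
by rewrite -[RHS]mul1mx -(mulVmx Hu) -mulmxA HK mulmx1.
Qed.

(** Conjugation by [P] preserves the Frobenius norm and makes [invmx H] and [Xs] diagonal. Off the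
    diagonal both sides agree; on it the difference is twice the product in [clip_obtuse]. *)
Lemma proj_pythagoras X : Sset tau zeta X ->
  fnorm (invmx H - Xs) ^+ 2 + fnorm (Xs - X) ^+ 2 <= fnorm (invmx H - X) ^+ 2.
Proof.
move=> SX; rewrite invmx_diag_conj /Xs; set D := diag_mx _; set C := diag_mx c.
have key Z T : fnorm (Z - T) ^+ 2 = fnorm (P *m Z *m P^T - P *m T *m P^T) ^+ 2.
  by rewrite -mulmxBl -mulmxBr fnorm_orthogonal.
have conjK (e : 'rV[R]_d) : P *m (P^T *m diag_mx e *m P) *m P^T = diag_mx e.
  by rewrite !mulmxA PP' mul1mx -mulmxA PP' mulmx1.
rewrite [X in X + _]key [X in _ + X]key [leRHS]key !conjK.
have := fun i => Sset_conj_diag i PP SX; move: (P *m X *m _) => Y Y_itv.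
rewrite !fnorm_sqr -big_split/=; apply: ler_sum => i _.
rewrite -big_split/=; apply: ler_sum => j _; rewrite !mxE.
have [->|_] := eqVneq i j; rewrite ?mulr1n ?mulr0n; last by rewrite subrr expr0n add0r.
  have := clip_obtuse (lam 0 j)^-1 (Y_itv j).
  by move: (clip _ _ _) => x; move: (lam 0 j)^-1 (Y j j) => y z h; nra.
Qed.

(** The Pythagorean inequality shows that [Xs] is a minimizer, and that any minimizer is at distance
    0 from it, which determines the choice made by [xget]. *)
Lemma proj_mx_setE : proj_mx_set (Sset tau zeta) (invmx H) = Xs.
Proof.
have le2 (A B : 'M[R]_d) : (fnorm A <= fnorm B) = (fnorm A ^+ 2 <= fnorm B ^+ 2).
  by rewrite ler_sqr ?nnegrE ?fnorm_ge0.
rewrite /proj_mx_set; case: xgetP => [X _ [SX Xmin]|]; last first.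
  move=> /(_ Xs) []; split=> // X SX; rewrite le2.
  by have := proj_pythagoras SX; have := sqr_ge0 (fnorm (Xs - X)); lra.
apply/esym/eqP; rewrite -subr_eq0; apply/eqP/fnorm_eq0.
have := Xmin _ XsS; rewrite le2.
have := proj_pythagoras SX; have := sqr_ge0 (fnorm (Xs - X)) => ? ? ?; lra.
Qed.

(** For quadratic [f], the [Sigma]-dependent part of the objective divided by [alpha^2 / 2]. *)
Let logdet_obj (X : 'M[R]_d) := \tr (H *m X) - ln (\det X).

Lemma logdet_obj_min X : Sset tau zeta X ->
  logdet_obj Xs <= logdet_obj X /\ (logdet_obj X = logdet_obj Xs -> X = Xs).
Proof.
move=> SX; have [symX _ _] := SX.
pose s : 'rV[R]_d := \row_i (Num.sqrt (c 0 i))^-1.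
(* [W] is normalized so that [W Xs W^T = 1]; hence [M] measures [X] relative to [Xs]. *)
pose W := diag_mx s *m P; pose M := W *m X *m W^T.
have s2 i : s 0 i * s 0 i = (c 0 i)^-1.
  by rewrite mxE -invfM -expr2 sqr_sqrtr// ltW.
pose t : 'rV[R]_d := \row_i Num.sqrt (c 0 i).
have ts : diag_mx t *m diag_mx s = 1%:M.
  rewrite mulmx_diag (_ : \row_i _ = const_mx 1) ?diag_const_mx//.
  apply/rowP => i; have := c0 i; rewrite !mxE => ci0.
  by rewrite divff// gt_eqF// sqrtr_gt0.
pose V := P^T *m diag_mx t.
have VW : V *m W = 1%:M by rewrite /V /W mulmxA -(mulmxA P^T) ts mulmx1.
have symM : M^T = M.
  by rewrite /M !(trmx_mul (_ *m _)) trmxK trmx_mul (symX : X^T = X) mulmxA.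
have WT : W^T = P^T *m diag_mx s by rewrite /W trmx_mul tr_diag_mx.
have M0 (x : 'cV[R]_d) : x != 0 -> 0 < dotv x (M *m x).
  move=> x0; rewrite /M -(mulmxA W) -(mulmxA W) -mulmxA dotv_mulmxr.
  apply: (Sset_gt0 zeta0 SX); apply: contra_neq x0 => Wx0.
  by rewrite -[x]mul1mx -trmx1 -(mulmx1C VW) trmx_mul -mulmxA Wx0 mulmx0.
have [le_tr eq_tr] := ln_det_le_mxtrace symM M0.
have [Y YE] : exists Y, Y = P *m X *m P^T by exists (P *m X *m P^T).
have Y_itv i : zeta^-1 <= Y i i <= tau^-1 by rewrite YE; exact: Sset_conj_diag.
have ME : M = diag_mx s *m Y *m diag_mx s by rewrite /M WT /W YE !mulmxA.
have trM : \tr M = \sum_i (c 0 i)^-1 * Y i i.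
  rewrite ME mxtrace_mulC mulmxA mulmx_diag mul_diag_mx.
  by apply: eq_bigr => i _; rewrite mxE [(\row__ _) 0 i]mxE s2.
have detX : 0 < \det X by apply: posdef_det_gt0 => // x; exact: Sset_gt0 SX.
have detXs : \det Xs = \prod_i c 0 i.
  exact: det_diag_conj.
have detM : \det M = \det X / \det Xs.
  rewrite detXs ME !det_mulmx mulrAC mulrC; congr (_ * _).
    by rewrite YE !det_mulmx mulrAC -det_mulmx PP' det1 mul1r.
  rewrite -prodfV -det_mulmx mulmx_diag det_diag.
  by apply: eq_bigr => i _; rewrite mxE s2.
have trH Z : \tr (H *m Z) = \sum_i lam 0 i * (P *m Z *m P^T) i i.
  rewrite /H -!mulmxA mxtrace_mulC -!mulmxA mul_diag_mx.
  by apply: eq_bigr => i _; rewrite mxE.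
have trHX : \tr (H *m X) = \sum_i lam 0 i * Y i i by rewrite trH YE.
have trHXs : \tr (H *m Xs) = \sum_i lam 0 i * c 0 i.
  rewrite trH; apply: eq_bigr => i _; congr (_ * _).
  by rewrite /Xs !mulmxA PP' mul1mx -mulmxA PP' mulmx1 [LHS]mxE eqxx mulr1n.
have gap : 0 <= \sum_i (lam 0 i - (c 0 i)^-1) * (Y i i - c 0 i).
  apply: sumr_ge0 => i _; have := clip_obtuse (lam 0 i)^-1 (Y_itv i).
  have -> : clip zeta^-1 tau^-1 (lam 0 i)^-1 = c 0 i by rewrite mxE.
  (* Since [lam - 1/c = (lam/c) (c - 1/lam)], each term is a positive multiple of the clipping
     product. *)
  move=> ob; rewrite (_ : _ * _ = lam 0 i / c 0 i *
    (((lam 0 i)^-1 - c 0 i) * (c 0 i - Y i i))).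
    by rewrite mulr_ge0// divr_ge0// ltW.
  by field; rewrite !gt_eqF.
(* The excess is split into a first-order term, nonnegative by clipping, and the tangent-plane
   defect of [ln det] at [M]. *)
have gapE : logdet_obj X - logdet_obj Xs =
    \sum_i (lam 0 i - (c 0 i)^-1) * (Y i i - c 0 i) +
    (\tr M - d%:R - ln (\det M)).
  rewrite /logdet_obj detM ln_div ?posrE//; last first.
    by rewrite detXs prodr_gt0.
  rewrite trHX trHXs trM.
  have -> : d%:R = \sum_(i < d) 1 :> R by rewrite sumr_const card_ord.
  have -> : \sum_i (lam 0 i - (c 0 i)^-1) * (Y i i - c 0 i) =
      \sum_i lam 0 i * Y i i - \sum_i lam 0 i * c 0 i -
      (\sum_i (c 0 i)^-1 * Y i i - \sum_(i < d) 1).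
    by rewrite -!sumrB; apply: eq_bigr => i _; field; rewrite gt_eqF.
  by ring.
split; first by rewrite -subr_ge0 gapE addr_ge0// subr_ge0.
move=> /eqP; rewrite -subr_eq0 gapE => /eqP eq0.
(* Two nonnegative terms with zero sum both vanish. Undoing the normalization with the inverse [V]
   of [W] then gives [X = V V^T = Xs]. *)
have M1 : M = 1%:M by apply: eq_tr; lra.
have -> : X = V *m M *m V^T.
  rewrite /M (mulmxA V (W *m X)) (mulmxA V W) VW mul1mx.
  by rewrite -(mulmxA X) -trmx_mul VW trmx1 mulmx1.
rewrite M1 mulmx1 /V trmx_mul tr_diag_mx trmxK !mulmxA.
rewrite -(mulmxA P^T (diag_mx _)) mulmx_diag; congr (_ *m diag_mx _ *m _).
apply/rowP => i; rewrite !mxE -expr2 sqr_sqrtr//.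
by have := c0 i; rewrite mxE => /ltW.
Qed.
End Clipping.

(** * Gaussian moments *)

Section StandardNormal.
Context {R : realType}.
Local Notation mu := (@lebesgue_measure R).
Local Notation N01 := (@normal_prob R 0 1).
Local Notation w := (@normal_pdf R 0 1).

Lemma normal_pdf01E x : w x = normal_peak 1 * expR (- x ^+ 2 / 2).
Proof.
by rewrite normal_pdfE ?oner_neq0// /normal_fun subr0 expr1n.
Qed.

Lemma normal_pdf01N x : w (- x) = w x.
Proof. by rewrite !normal_pdf01E sqrrN. Qed.

Lemma continuous_normal_pdf01 : continuous w.
Proof. exact/continuous_normal_pdf/oner_neq0. Qed.

Global Instance is_derive_normal_pdf01 (x : R) : is_derive x 1 w (- x * w x).
Proof.
have -> : w = (fun x => normal_peak 1 * expR (- x ^+ 2 / 2)).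
  by apply/funext => y; rewrite normal_pdf01E.
apply: is_derive_eq.
by rewrite /= !scaler0 ?add0r ?addr0 /GRing.scale/=; field.
Qed.

(** Each side is the sum of the integrals of [g x] and [g (- x)] over the nonnegative half-line, in
    opposite orders. *)
Lemma ge0_integral_reflect (g : R -> R) :
  (forall x, 0 <= g x) -> continuous g ->
  (\int[mu]_x (g x)%:E = \int[mu]_x (g (- x))%:E)%E.
Proof.
move=> g0 cg.
have split_int (h : R -> R) : (forall x, 0 <= h x) -> continuous h ->
    (\int[mu]_x (h x)%:E = \int[mu]_(x in `[0%R, +oo[) (h x)%:E +
      \int[mu]_(x in `[0%R, +oo[) (h (- x))%:E)%E.
  move=> h0 ch.
  have mh : measurable_fun [set: R] h by exact: continuous_measurable_fun.
  rewrite -(setUv `[0%R, +oo[) ge0_integral_setU//=; last 4 first.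
  - exact: measurableC.
  - by apply/measurable_EFinP; rewrite setUv.
  - by move=> x _; rewrite lee_fin.
  - exact/disj_setPCl.
  congr (_ + _)%E.
  rewrite setCitvr integral_itv_bndo_bndc; last first.
    exact/measurable_EFinP/measurable_funTS.
  by rewrite -{1}oppr0 ge0_integration_by_substitutionNy//; exact: continuous_subspaceT.
rewrite (split_int g)// (split_int (fun x => g (- x)))//=; last first.
  move=> x; apply: (@continuous_comp _ _ _ -%R g); last exact: cg.
  by apply: (@continuousN _ R^o); exact: cvg_id.
by under [X in _ = _ + X]eq_integral do rewrite opprK; rewrite addeC.
Qed.

(** The Radon-Nikodym derivative of [N01] agrees almost everywhere with the density [w], because
    both integrate to [N01] over every measurable set. *)
Lemma ge0_integral_normal01 (g : R -> R) : (forall x, 0 <= g x) ->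
  measurable_fun setT g ->
  (\int[N01]_x (g x)%:E = \int[mu]_x (g x * w x)%:E)%E.
Proof.
move=> g0 mg.
have dom := @normal_prob_dominates R 0 1.
rewrite -(Radon_Nikodym_SigmaFinite.change_of_variables dom)//; last first.
  exact/measurable_EFinP.
under [in RHS]eq_integral do rewrite EFinM.
have mw : measurable_fun [set: R] (EFin \o w).
  apply/measurable_EFinP; exact: measurable_normal_pdf.
apply: ae_eq_integral => //.
- apply: emeasurable_funM; first exact/measurable_EFinP.
  exact: measurable_int (Radon_Nikodym_SigmaFinite.f_integrable _).
- by apply: emeasurable_funM => //; exact/measurable_EFinP.
- apply: ae_eqe_mul2l; apply: integral_ae_eq => //.
  + exact: Radon_Nikodym_SigmaFinite.f_integrable.
  + by move=> E _ mE; rewrite -Radon_Nikodym_SigmaFinite.f_integral.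
Qed.

(** Half of the total mass, by evenness; the value [+oo] is excluded because its double is not 1. *)
Lemma integral0y_normal_pdf01 :
  (\int[mu]_(x in `[0%R, +oo[) (w x)%:E = (2^-1)%:E)%E.
Proof.
have := @integral_normal_pdf R 0 1; rewrite ge0_symfun_integralT; last 3 first.
- exact: normal_pdf_ge0.
- exact: continuous_normal_pdf01.
- by move=> x; rewrite /= normal_pdf01N.
rewrite -set_itvcy//.
have : (0 <= \int[mu]_(x in `[0%R, +oo[) (w x)%:E)%E.
  by apply: integral_ge0 => x _; rewrite lee_fin normal_pdf_ge0.
case: (integral _ _ _) => [r| |] //= _.
- by rewrite -EFinM => -[r2]; congr (_%:E); lra.
- by rewrite mulry gtr0_sg// mul1e.
Qed.

(** Integration by parts, with [- w] as a primitive of [x * w x]. The bound [n = 0] is treated apart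
    because the rule requires a nondegenerate interval. *)
Lemma integral0n_sqr_normal_pdf01 (n : nat) :
  (\int[mu]_(x in `[0%R, n%:R]) (x ^+ 2 * w x)%:E =
   \int[mu]_(x in `[0%R, n%:R]) (w x)%:E - (n%:R * w n%:R)%:E)%E.
Proof.
case: n => [|n]; first by rewrite !set_itv1 !integral_set1 mul0r sube0.
have cw (x : R) : {for x, continuous w} by exact: continuous_normal_pdf01.
have cxw (x : R) : {for x, continuous (fun y : R => y * w y)}.
  by apply: cvgM; [exact: cvg_id|exact: cw].
have := @integration_by_parts R id (fun x => - w x) (cst 1) (fun x => x * w x)
  0 n.+1%:R.
rewrite ltr0n => /(_ isT) => ibp.
transitivity (\int[mu]_(x in `[0%R, n.+1%:R]) (x * (x * w x))%:E)%E.
  by apply: eq_integral => x _; rewrite expr2 mulrA.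
rewrite ibp.
- rewrite mul0r subr0 mulrN EFinN addeC; congr (_ + _)%E.
  under eq_integral do rewrite mul1r EFinN -mulN1e.
  rewrite integralZl//= ?mulN1e ?oppeK//.
  by apply: integrableS (@integrable_normal_pdf R 0 1).
- exact/continuous_subspaceT/cst_continuous.
- split=> //.
  + by apply: cvg_at_right_filter; exact: cvg_id.
  + by apply: cvg_at_left_filter; exact: cvg_id.
- by move=> x _; rewrite derive1E derive_id.
- exact: continuous_subspaceT.
- split=> [x _||].
  + by case: (is_deriveN (is_derive_normal_pdf01 x)).
  + by apply: cvg_at_right_filter; apply: cvgN; exact: cw.
  + by apply: cvg_at_left_filter; apply: cvgN; exact: cw.
- move=> x _; rewrite derive1E.
  by case: (is_deriveN (is_derive_normal_pdf01 x)) => _ ->; rewrite mulNr opprK.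
Qed.

(** Let [n] tend to infinity in the truncated identity; the boundary term [n * w n] vanishes. *)
Lemma integral0y_sqr_normal_pdf01 :
  (\int[mu]_(x in `[0%R, +oo[) (x ^+ 2 * w x)%:E = (2^-1)%:E)%E.
Proof.
have x2w0 (x : R) : 0 <= x ^+ 2 * w x by rewrite mulr_ge0 ?sqr_ge0 ?normal_pdf_ge0.
have mw : measurable_fun [set: R] w by exact: measurable_normal_pdf.
have mx2w : measurable_fun [set: R] (fun x => x ^+ 2 * w x).
  by apply: measurable_funM => //; exact: exprn_measurable.
have lim2 := @ge0_cvgn_integral R mu _ x2w0 mx2w.
have lim0 := @ge0_cvgn_integral R mu _ (@normal_pdf_ge0 R 0 1) mw.
have limn : ((n%:R * w n%:R)%:E @[n --> \oo] --> (0 : \bar R))%E.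
  apply: cvg_EFin; first exact: nearW.
  (* The constant 4 comes from [n (n + 1) <= 2 n^2 <= 4 (1 + n^2 / 2) <= 4 exp (n^2 / 2)]. *)
  apply: (@squeeze_cvgr _ _ _ _ (cst 0) (fun n => normal_peak 1 * 4 * n.+1%:R^-1)).
  - apply: nearW => n; rewrite mulr_ge0 ?normal_pdf_ge0//= normal_pdf01E.
    rewrite mulrCA -mulrA ler_wpM2l ?normal_peak_ge0//.
    rewrite mulNr expRN ler_pdivrMr ?expR_gt0// mulrAC ler_pdivlMr ?ltr0n//.
    have := expR_ge1Dx (n%:R ^+ 2 / 2 : R).
    have : n%:R * n.+1%:R <= 2 * n%:R ^+ 2 :> R.
      by rewrite -natrX -!natrM ler_nat -mulnn mulnCA leq_mul2l; lia.
    set e := expR _ => ? ?; lra.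
  - exact: cvg_cst.
  - rewrite -[X in _ --> X](mulr0 (normal_peak 1 * 4)).
    by apply: cvgM; [exact: cvg_cst|exact: cvg_harmonic].
have lim1 : ((\int[mu]_(x in `[0%R, n%:R]) (x ^+ 2 * w x)%:E)%E @[n --> \oo]
    --> (2^-1)%:E)%E.
  under eq_cvg do rewrite integral0n_sqr_normal_pdf01.
  have := cvgeB _ lim0 limn; rewrite integral0y_normal_pdf01 sube0; exact.
exact: (cvg_unique _ lim2 lim1).
Qed.

Lemma integral_sqr_normal01 : (\int[N01]_x (x ^+ 2)%:E = 1)%E.
Proof.
have x2w0 (x : R) : 0 <= x ^+ 2 * w x by rewrite mulr_ge0 ?sqr_ge0 ?normal_pdf_ge0.
rewrite (@ge0_integral_normal01 (fun x => x ^+ 2)); last 2 first.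
- by move=> x; exact: sqr_ge0.
- exact: exprn_measurable.
rewrite ge0_symfun_integralT//.
- rewrite -set_itvcy// integral0y_sqr_normal_pdf01 -EFinM divff//.
- move=> x; apply: cvgM; first exact: sqr_continuous.
  exact: continuous_normal_pdf01.
- by move=> x; rewrite /= sqrrN normal_pdf01N.
Qed.

Lemma integrable_sqr_normal01 : N01.-integrable setT (fun x => (x ^+ 2)%:E).
Proof.
apply/integrableP; split.
  by apply/measurable_EFinP; exact: exprn_measurable.
under eq_integral do rewrite gee0_abs ?lee_fin ?sqr_ge0//.
by rewrite integral_sqr_normal01 ltry.
Qed.

Lemma integrable_id_normal01 : N01.-integrable setT (fun x => x%:E).
Proof.
(* An integrable function dominating the absolute value of [x]. *)
have int1 : N01.-integrable setT (fun x => (1 + x ^+ 2)%:E).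
  under eq_fun do rewrite EFinD.
  apply: integrableD => //; last exact: integrable_sqr_normal01.
  exact: finite_measure_integrable_cst.
apply: (le_integrable measurableT _ _ int1); first exact/measurable_EFinP.
move=> x _; rewrite lee_fin [leRHS]ger0_norm; last by have := sqr_ge0 x; lra.
by rewrite ler_norml; apply/andP; split; nra.
Qed.

(** The positive and negative parts have equal integrals by reflection, as [w] is even;
    integrability makes them finite, so their difference is 0. *)
Lemma integral_id_normal01 : (\int[N01]_x x%:E = 0)%E.
Proof.
have max0 (x : R) : 0 <= Num.max x 0 by rewrite le_max lexx orbT.
have cmax : continuous (fun x : R => Num.max x 0).
  by move=> x; apply: continuous_max; [exact: cvg_id|exact: cvg_cst].
have E0 : (\int[N01]_x (Num.max x 0)%:E = \int[N01]_x (Num.max (- x) 0)%:E)%E.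
  rewrite (ge0_integral_normal01 max0); last exact: continuous_measurable_fun.
  rewrite ge0_integral_reflect; last 2 first.
  - by move=> x; rewrite mulr_ge0// normal_pdf_ge0.
  - by move=> x; apply: cvgM; [exact: cmax|exact: continuous_normal_pdf01].
  under eq_integral do rewrite normal_pdf01N.
  rewrite (@ge0_integral_normal01 (fun x => Num.max (- x) 0))//.
  by apply: measurable_maxr => //; exact: oppr_measurable.
rewrite integralE.
under eq_integral do rewrite funeposE -EFin_max.
under [X in (_ - X)%E]eq_integral do rewrite funenegE -EFinN -EFin_max.
rewrite -E0 subee//.
have := integrable_funepos measurableT integrable_id_normal01.
move=> /integrable_fin_num; under eq_integral do rewrite funeposE -EFin_max.
exact.
Qed.

End StandardNormal.

(** * Fubini for products of functions of separate variables *)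

Section ProductIntegral.
Context d1 d2 (T1 : measurableType d1) (T2 : measurableType d2) (R : realType).
Variables (m1 : {sigma_finite_measure set T1 -> \bar R}).
Variables (m2 : {sigma_finite_measure set T2 -> \bar R}).
Variables (g : T1 -> R) (h : T2 -> R).
Hypotheses (ig : m1.-integrable setT (EFin \o g)).
Hypotheses (ih : m2.-integrable setT (EFin \o h)).

Let mgh : measurable_fun setT (fun z : T1 * T2 => (g z.1 * h z.2)%:E).
Proof.
have mg := (measurable_EFinP _ _).1 (measurable_int _ ig).
have mh := (measurable_EFinP _ _).1 (measurable_int _ ih).
apply/measurable_EFinP; apply: measurable_funM.
  exact: (measurableT_comp mg measurable_fst).
exact: (measurableT_comp mh measurable_snd).
Qed.

(** The iterated integral of the absolute value factors into two finite integrals. *)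
Lemma integrable_prod_mul :
  (m1 \x m2)%E.-integrable setT (fun z => (g z.1 * h z.2)%:E).
Proof.
apply/integrable12ltyP => //=.
have ihy : (\int[m2]_y `|(h y)%:E| < +oo)%E by case/integrableP : ih.
have igy : (\int[m1]_x `|(g x)%:E| < +oo)%E by case/integrableP : ig.
have mh : measurable_fun setT (EFin \o h) by exact: measurable_int ih.
have mg : measurable_fun setT (EFin \o g) by exact: measurable_int ig.
have inner x : (\int[m2]_y `|(g x * h y)%:E| =
    `|(g x)%:E| * \int[m2]_y `|(h y)%:E|)%E.
  under eq_integral do rewrite EFinM abseM.
  by rewrite ge0_integralZl//; exact: measurableT_comp.
under eq_integral do rewrite inner.
rewrite ge0_integralZr//; last 2 first.
- exact: measurableT_comp.
- exact: integral_ge0.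
apply: lte_mul_pinfty => //; first exact: integral_ge0.
by rewrite ge0_fin_numE//; exact: integral_ge0.
Qed.

Lemma integral_prod_mul :
  (\int[m1 \x m2]_z (g z.1 * h z.2)%:E =
   (\int[m1]_x (g x)%:E) * (\int[m2]_y (h y)%:E))%E.
Proof.
rewrite -integral12_prod_meas1; last exact: integrable_prod_mul.
rewrite /fubini_F/=.
have hfin : (\int[m2]_y (h y)%:E)%E \is a fin_num by exact: integrable_fin_num ih.
have inner x : (\int[m2]_y (g x * h y)%:E = (g x)%:E * \int[m2]_y (h y)%:E)%E.
  by under eq_integral do rewrite EFinM; rewrite integralZl.
under eq_integral do rewrite inner -(fineK hfin).
by rewrite integralZr// fineK.
Qed.

End ProductIntegral.

(** * Linearity of the mean *)

Section Mean.
Context d (T : measurableType d) (R : realType) (P : probability T R).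
Implicit Types (f g : T -> R) (a b : R).

(** Integrability travels with the value, so that sums and products can be chained without separate
    side conditions. *)
Definition has_mean f a :=
  P.-integrable setT (EFin \o f) /\ (\int[P]_x (f x)%:E = a%:E)%E.

Lemma has_mean_cst a : has_mean (cst a) a.
Proof.
split; first exact: finite_measure_integrable_cst.
apply: etrans (@integral_cst _ _ _ P setT measurableT a%:E) _.
by rewrite /= probability_setT mule1.
Qed.

Lemma has_meanD f g a b : has_mean f a -> has_mean g b ->
  has_mean (fun x => f x + g x) (a + b).
Proof.
move=> [If fa] [Ig gb]; split; first exact: (integrableD measurableT If Ig).
by under eq_integral do rewrite EFinD; rewrite integralD// fa gb.
Qed.

Lemma has_meanZ f a k : has_mean f a -> has_mean (fun x => k * f x) (k * a).
Proof.
move=> [If fa]; split; first exact: (integrableZl measurableT k If).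
by under eq_integral do rewrite EFinM; rewrite integralZl// fa.
Qed.

Lemma has_mean_sum n (f : 'I_n -> T -> R) (a : 'I_n -> R) :
  (forall i, has_mean (f i) (a i)) ->
  has_mean (fun x => \sum_i f i x) (\sum_i a i).
Proof.
elim: n f a => [|n IHn] f a fa.
  rewrite big_ord0 (_ : (fun _ => _) = cst 0); first exact: has_mean_cst.
  by apply/funext => x; rewrite big_ord0.
rewrite big_ord_recl (_ : (fun _ => _) =
    (fun x => f ord0 x + \sum_(i < n) f (lift ord0 i) x)).
  by apply: has_meanD => //; apply: IHn => i; exact: fa.
by apply/funext => x; rewrite big_ord_recl.
Qed.

End Mean.

(** * First and second moments of the standard Gaussian vector *)

Section GaussianMoments.
Context {R : realType}.

(** The inductive step for the moments: the law in dimension [n.+1] is the image of a product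
    measure, so a function of the head times a function of the tail has the product of the means. *)
Lemma std_gaussian_cons n (f : n.+1.-tuple (measurableTypeR R) -> R)
    (g : measurableTypeR R -> R) (h : n.-tuple (measurableTypeR R) -> R) a b :
  measurable_fun setT f ->
  (forall x u, f (cons_pair (x, u)) = g x * h u) ->
  has_mean (normal_prob 0 1) g a -> has_mean (std_gaussian n) h b ->
  has_mean (std_gaussian n.+1) f (a * b).
Proof.
move=> mf fE [ig ga] [ih hb].
have mf' : measurable_fun setT (EFin \o f) by exact/measurable_EFinP.
have fE' : (EFin \o f) \o @cons_pair R n = (fun z => (g z.1 * h z.2)%:E).
  by apply/funext => -[x u] /=; rewrite fE.
have int_f : (normal_prob 0 1 \x std_gaussian n)%E.-integrable setT
    ((EFin \o f) \o @cons_pair R n).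
  by rewrite fE'; exact: integrable_prod_mul.
split; first exact: integrable_pushforward.
by rewrite /= integral_distribution// fE' integral_prod_mul// ga hb.
Qed.

Lemma measurable_tnthR n (i : 'I_n) :
  measurable_fun setT (fun u : n.-tuple (measurableTypeR R) => tnth u i : R).
Proof. exact: measurable_tnth. Qed.

Lemma std_gaussian_mean n i :
  has_mean (std_gaussian n) (fun u : n.-tuple (measurableTypeR R) => tnth u i : R) 0.
Proof.
elim: n i => [[]//|n IHn] i.
have [j ->|->] := unliftP ord0 i.
- rewrite -(mul1r 0); apply: (std_gaussian_cons _ _ (has_mean_cst _ 1) (IHn j)).
    exact: measurable_tnthR.
  by move=> x u; rewrite tnthS mul1r.
- rewrite -(mulr1 0); apply: (std_gaussian_cons (g := id) _ _ _ (has_mean_cst _ 1)).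
  + exact: measurable_tnthR.
  + by move=> x u; rewrite tnth0 mulr1.
  + by split; [exact: integrable_id_normal01|exact: integral_id_normal01].
Qed.

(** Each index is the head or lies in the tail. Two tail indices use induction, mixed ones give a
    product of zero means, and two heads give the scalar second moment. *)
Lemma std_gaussian_covariance n (i j : 'I_n) :
  has_mean (std_gaussian n)
    (fun u : n.-tuple (measurableTypeR R) => (tnth u i : R) * tnth u j)
    (i == j)%:R.
Proof.
elim: n i j => [[]//|n IHn] i j.
have mij : measurable_fun setT
    (fun u : n.+1.-tuple (measurableTypeR R) => (tnth u i : R) * tnth u j).
  by apply: measurable_funM; exact: measurable_tnthR.
have mean_id : has_mean (@normal_prob R 0 1) id 0.
  by split; [exact: integrable_id_normal01|exact: integral_id_normal01].
case: (unliftP ord0 i) mij => [i'|] ->; case: (unliftP ord0 j) => [j'|] -> mij.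
- rewrite (inj_eq lift_inj) -[_%:R]mul1r.
  apply: (std_gaussian_cons _ _ (has_mean_cst _ 1) (IHn i' j')) => //.
  by move=> x u; rewrite !tnthS mul1r.
- rewrite eq_sym (negbTE (neq_lift _ _)) -[0%:R](mulr0 0).
  apply: (std_gaussian_cons _ _ mean_id (std_gaussian_mean i')) => //.
  by move=> x u; rewrite tnthS tnth0 mulrC.
- rewrite (negbTE (neq_lift _ _)) -[0%:R](mulr0 0).
  apply: (std_gaussian_cons _ _ mean_id (std_gaussian_mean j')) => //.
  by move=> x u; rewrite tnthS tnth0.
- rewrite eqxx -[1%:R](mulr1 1).
  apply: (std_gaussian_cons (g := fun x => x ^+ 2) _ _ _ (has_mean_cst _ 1)) => //.
  + by move=> x u; rewrite tnth0 mulr1 expr2.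
  + by split; [exact: integrable_sqr_normal01|exact: integral_sqr_normal01].
Qed.

(** Expand into monomials: the linear ones have mean 0, and only the diagonal quadratic ones
    survive. *)
Lemma std_gaussian_quadratic n (c : R) (b : 'cV[R]_n) (A : 'M[R]_n) :
  has_mean (std_gaussian n) (fun u => c + dotv b (col_of_tuple u)
    + dotv (col_of_tuple u) (A *m col_of_tuple u)) (c + \tr A).
Proof.
have -> : (fun u : n.-tuple (measurableTypeR R) => c + dotv b (col_of_tuple u)
    + dotv (col_of_tuple u) (A *m col_of_tuple u)) = (fun u =>
    c + \sum_i b i 0 * tnth u i + \sum_i \sum_j A i j * (tnth u i * tnth u j)).
  apply/funext => u; congr (_ + _ + _).
    by rewrite /dotv mxE; apply: eq_bigr => i _; rewrite !mxE.
  rewrite /dotv mxE; apply: eq_bigr => i _; rewrite !mxE big_distrr/=.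
  by apply: eq_bigr => j _; rewrite !mxE mulrCA mulrA.
have -> : c + \tr A =
    c + \sum_i b i 0 * 0 + \sum_i \sum_j A i j * (i == j)%:R.
  rewrite [X in c + X + _]big1 ?addr0; last by move=> i _; rewrite mulr0.
  congr (_ + _); apply: eq_bigr => i _.
  rewrite (bigD1 i)//= eqxx mulr1 big1 ?addr0// => j ji.
  by rewrite eq_sym (negbTE ji) mulr0.
apply: has_meanD; first apply: has_meanD.
- exact: has_mean_cst.
- by apply: has_mean_sum => i; apply: has_meanZ; exact: std_gaussian_mean.
- apply: has_mean_sum => i; apply: has_mean_sum => j; apply: has_meanZ.
  exact: std_gaussian_covariance.
Qed.

End GaussianMoments.

(** * Quadratic functions *)

Section DotProduct.
Context {R : realType} {d : nat}.
Implicit Types (u v w : 'cV[R]_d) (a : R).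

Lemma dotvC u v : dotv u v = dotv v u.
Proof. by rewrite !dotvE; apply: eq_bigr => i _; rewrite mulrC. Qed.

Lemma dotvDl u v w : dotv (u + v) w = dotv u w + dotv v w.
Proof. by rewrite !dotvE -big_split/=; apply: eq_bigr => i _; rewrite mxE mulrDl. Qed.

Lemma dotvDr u v w : dotv u (v + w) = dotv u v + dotv u w.
Proof. by rewrite !(dotvC u) dotvDl. Qed.

Lemma dotvZl a u v : dotv (a *: u) v = a * dotv u v.
Proof. by rewrite !dotvE big_distrr/=; apply: eq_bigr => i _; rewrite mxE mulrA. Qed.

Lemma dotvZr a u v : dotv u (a *: v) = a * dotv u v.
Proof. by rewrite !(dotvC u) dotvZl. Qed.

Lemma dotvBl u v w : dotv (u - v) w = dotv u w - dotv v w.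
Proof. by rewrite -scaleN1r dotvDl dotvZl mulN1r. Qed.

Lemma dotv_gt0 u : u != 0 -> 0 < dotv u u.
Proof.
move=> u0; rewrite lt_neqAle trmx_mul_self_ge0 andbT eq_sym.
by apply: contra_neq u0 => /trmx_mul_self_eq0.
Qed.

Lemma dotv_inj u v : (forall w, dotv u w = dotv v w) -> u = v.
Proof.
move=> uv; apply/eqP; rewrite -subr_eq0; apply/eqP/trmx_mul_self_eq0.
by rewrite -/(dotv _ _) dotvBl uv subrr.
Qed.

End DotProduct.

Section Quadratic.
Context {R : realType} {d : nat}.
Variables (f : 'cV[R]_d -> R) (H : 'M[R]_d).
Hypothesis hquad : quadratic_with_hessian f H.

Lemma quadraticD mu h :
  f (mu + h) = f mu + dotv (grad f mu) h + 2^-1 * dotv h (H *m h).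
Proof. by have [_ fE] := hquad; rewrite (fE (mu + h) mu) (addrC mu h) addrK. Qed.

(** Expand [f (mu + h)] around [0] and around [mu] and compare the terms linear in [h]. The
    symmetric part of [H] appears because the symmetry of [H] is derived from this formula
    afterwards. *)
Lemma grad_quadratic mu :
  grad f mu = grad f 0 + (2^-1 *: (H + H^T)) *m mu.
Proof.
apply: dotv_inj => h.
have := quadraticD 0 (mu + h); rewrite add0r quadraticD -[mu in f mu]add0r quadraticD.
rewrite !(mulmxDr, dotvDr, dotvDl) -scalemxAl dotvZl mulmxDl dotvDl.
rewrite -dotv_mulmxr (dotvC (H *m mu) h).
lra.
Qed.

(** The difference quotient equals [c] at every nonzero [t]. *)
Lemma derive_affine (V : normedModType R) (phi : V -> R) (a v : V) (c : R) :
  (forall t : R, phi (t *: v + a) = phi a + t * c) -> 'D_v phi a = c.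
Proof.
move=> phiE; apply: cvg_lim => //.
apply: cvg_trans (@cvg_cst _ c _ (0^'  : set_system R) _).
apply: near_eq_cvg; near=> t => /=.
rewrite phiE addrAC subrr add0r.
have t0 : t != 0 by near: t; exact: nbhs_dnbhs_neq.
by rewrite /GRing.scale/= mulKf.
Unshelve. all: by end_near. Qed.

(** [H] collects the derivatives of the gradient, and the affine formula for the gradient makes
    these the entries of the symmetric part of [H]. *)
Lemma hessian_symmetric : H^T = H.
Proof.
have [hess _] := hquad.
have HE i j : H i j = (2^-1 *: (H + H^T)) j i.
  rewrite -{1}(hess 0) mxE.
  apply: derive_affine => t.
  have gradE y :
      'D_(basis_vec j) f y = (grad f 0 + (2^-1 *: (H + H^T)) *m y) j 0.
    by rewrite -grad_quadratic mxE.
  rewrite !gradE addr0 -scalemxAr -colE mulmx0 addr0.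
  by rewrite mxE; congr (_ + _); rewrite !mxE.
by apply/matrixP => i j; rewrite mxE !HE !mxE addrC.
Qed.

Lemma strongly_convex_quadratic sigma h : strongly_convex f sigma ->
  sigma * dotv h h <= dotv h (H *m h).
Proof.
move=> [_ /(_ h 0)]; rewrite subr0 fnorm_sqr_dotv.
by have := quadraticD 0 h; rewrite add0r => ->; lra.
Qed.

(** The gradient vanishes at the minimizer: otherwise a step against it would decrease [f]. *)
Lemma argmin_quadratic sigma mustar : 0 < sigma -> strongly_convex f sigma ->
  argmin setT f mustar ->
  forall h, f (mustar + h) = f mustar + 2^-1 * dotv h (H *m h).
Proof.
move=> sigma0 hconv [_ hmin] h.
suff g0 : grad f mustar = 0.
  by rewrite quadraticD g0 dotvE big1 ?addr0// => i _; rewrite mxE mul0r.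
set g := grad f mustar.
apply/eqP/negPn/negP => /dotv_gt0 gg.
set q := dotv g (H *m g).
have q0 : 0 <= q.
  by apply: le_trans (strongly_convex_quadratic _ hconv); rewrite mulr_ge0// ltW.
(* Close to the exact line-search step [- <g, g> / q]; the [+ 1] makes the denominator positive from
   [0 <= q]. The change in [f] is [- <g, g>^2 (1 + q/2) / (q + 1)^2], which is negative. *)
pose t := - (dotv g g / (q + 1)).
have := hmin (mustar + t *: g) I.
rewrite quadraticD -/g -scalemxAr !(dotvZl, dotvZr) -/q.
have -> : t * (t * q) = dotv g g * dotv g g * (q / (q + 1) ^+ 2).
  by rewrite /t; field; lra.
have -> : t * dotv g g = - (dotv g g * dotv g g * ((q + 1) / (q + 1) ^+ 2)).
  by rewrite /t; field; lra.
have : 0 < dotv g g * dotv g g by rewrite mulr_gt0.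
move: (dotv g g * dotv g g) => s s0.
have : 0 < ((q + 1) ^+ 2)^-1 by rewrite invr_gt0 exprn_gt0//; lra.
move: (_^-1) => r r0.
have : 0 < s * r by rewrite mulr_gt0.
have : 0 <= s * r * q by rewrite mulr_ge0// mulr_ge0// ltW.
move=> ? ? ?; lra.
Qed.

(** With [S] the root of [Sigma], the integrand is a quadratic polynomial in [u] with matrix
    [alpha^2/2 S H S], and [tr (S H S) = tr (H Sigma)] by cyclicity. *)
Lemma Jfun_quadratic alpha mu Sigma : psd_mx Sigma ->
  Jfun alpha f mu Sigma = f mu + alpha ^+ 2 / 2 * \tr (H *m Sigma).
Proof.
move=> /sqrt_mxP[[symS _] SS]; rewrite /Jfun unlock.
set S := sqrt_mx Sigma in symS SS *.
pose b := alpha *: (S *m grad f mu).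
pose A := (alpha ^+ 2 / 2) *: (S *m H *m S).
have fE u : f (mu + alpha *: (S *m col_of_tuple u)) =
    f mu + dotv b (col_of_tuple u) + dotv (col_of_tuple u) (A *m col_of_tuple u).
  rewrite quadraticD; congr (_ + _ + _).
    by rewrite /b dotvZl dotvZr dotv_mulmxr symS.
  rewrite /A -!scalemxAl -scalemxAr !(dotvZl, dotvZr) -!mulmxA.
  rewrite [in RHS]dotv_mulmxr symS.
  by ring.
have [_] := std_gaussian_quadratic (f mu) b A.
under eq_integral do rewrite -fE.
move=> ->; rewrite /= /A mxtraceZ mxtrace_mulC mulmxA SS mxtrace_mulC.
by [].
Qed.

End Quadratic.

Theorem theorem1 (R : realType) (d : nat) (alpha tau zeta L sigma : R)
    (f : 'cV[R]_d -> R) (H : 'M[R]_d) (mustar : 'cV[R]_d)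
    (halpha : 0 < alpha) (htau : 0 < tau) (hzeta : tau <= zeta)
    (hL : 0 < L) (hsigma : 0 < sigma)
    (hquad : quadratic_with_hessian f H)
    (hsmooth : smooth f L)
    (hconv : strongly_convex f sigma)
    (hmin : argmin setT f mustar) :
  argmin (setT `*` Sset tau zeta)
    (fun p : 'cV[R]_d * 'M[R]_d => Qfun alpha f p.1 p.2)
  = [set (mustar, proj_mx_set (Sset tau zeta) (invmx H))].
Proof.
have H0 (x : 'cV[R]_d) : x != 0 -> 0 < dotv x (H *m x).
  move=> /dotv_gt0 xx; apply: lt_le_trans (strongly_convex_quadratic hquad _ hconv).
  exact: mulr_gt0.
have fmin := argmin_quadratic hquad hsigma hconv hmin.
have f_ge mu : f mustar <= f mu by case: hmin => _; exact.
(* The excess of [f] over its minimum is half the positive definite form of [H] at [mu - mustar]. *)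
have f_eq mu : f mu = f mustar -> mu = mustar.
  rewrite -[mu](subrKC mustar) fmin => /eqP; rewrite -subr_eq0 addrAC subrr add0r.
  rewrite mulf_eq0 invr_eq0 pnatr_eq0/=; set h := mu - mustar.
  have [->|/H0 hH /eqP] := eqVneq h 0; first by rewrite addr0.
  by move=> hH0; rewrite hH0 ltxx in hH.
have zeta0 : 0 < zeta by exact: lt_le_trans hzeta.
have QE mu Sigma : Sset tau zeta Sigma -> Qfun alpha f mu Sigma =
    f mu + alpha ^+ 2 / 2 * (\tr (H *m Sigma) - ln (\det Sigma)).
  move=> SSigma; rewrite /Qfun (Jfun_quadratic hquad); first by ring.
  split; first by case: SSigma.
  move=> x; have [->|x0] := eqVneq x 0; first by rewrite mulmx0 /dotv mulmx0 mxE.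
  by rewrite ltW// (Sset_gt0 zeta0 SSigma).
have [P [lam [PP HE lam0]]] := posdef_spectral (hessian_symmetric hquad) H0.
rewrite HE proj_mx_setE//; set Xs := (_ *m diag_mx (\row_i _) *m _).
have XsS : Sset tau zeta Xs.
  by apply: Sset_diag_conj => // i; rewrite mxE clip_itv// lef_pV2.
have Xmin := logdet_obj_min htau hzeta PP lam0.
rewrite -HE -/Xs in Xmin.
have a0 : 0 < alpha ^+ 2 / 2 by rewrite divr_gt0// exprn_gt0.
(* A minimizer is compared with [(mustar, Xs)]: its excesses in [mu] and in [X] are both nonnegative
   with sum at most 0, so both vanish and the two equality cases apply. *)
apply/seteqP; split=> [[mu X] [[_ /= SX] /(_ (mustar, Xs))/=]|_ ->].
  rewrite !QE// => /(_ (conj I XsS)) le_Q.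
  have [le_X eq_X] := Xmin _ SX.
  have := f_ge mu; rewrite -(ler_pM2l a0) in le_X => le_f.
  congr (_, _).
    by apply: f_eq; lra.
  by apply: eq_X; apply: (mulfI (lt0r_neq0 a0)); lra.
split=> // -[mu X] [_ /= SX]; rewrite !QE//.
by rewrite lerD// ler_pM2l//; case: (Xmin _ SX).
Qed.
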